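(* Let $d\ge 1$ and let $\pi$ be a probability distribution on $(0,\infty)$ such that $\pi((0,r])>0$ for all $r>0$. Consider the frog model on $\mathbb{Z}^d$ with waiting time distribution $\pi$ and initial particle distribution $\mu$. Then there exists a probability distribution $\mu$ on $\mathbb{N}\cup\{0\}$ such that the time $$\tau := \inf\{t \ge 0 : \text{there are infinitely many active particles at time } t\}$$ is almost surely finite.
   Context: Frog model on $\mathbb{Z}^d$ with waiting time distribution $\pi$ (a probability distribution on $(0,\infty)$) and initial distribution $\mu$ (a probability distribution on $\mathbb{N}\cup\{0\}$): at time $t=0$ there are $\eta(x)$ particles at each $x\in\mathbb{Z}^d$, where $\{\eta(x)\}_{x\in\mathbb{Z}^d}$ are i.i.d. with distribution $\mu$. The particles at the origin are active at time $0$; all other particles are dormant. If $\eta(\mathbf{0})=0$, one active particle is added at the origin, so that there is always at least one active particle at the origin at time $0$. Active particles perform random walks for which the waiting times between successive jumps (including the time until the first jump) are independent with distribution $\pi$, and each jump is to a uniformly chosen nearest neighbour in $\mathbb{Z}^d$, independently of everything else; the walks are independent of each other and of $\eta$. Dormant particles stay put until the first arrival of an active particle at their site; upon arrival they become active and start their own random walks. Formally: let $(S^{(x,j)}_t)_{t\ge 0}$, $x\in\mathbb{Z}^d$, $j\in\mathbb{N}$, be independent such walks with $S^{(x,j)}_0=\mathbf{0}$, independent of $\eta$; the walk $(x,j)$ is used only if $j\le\eta(x)$ (for $x=\mathbf{0}$, if $j\le\max(\eta(\mathbf{0}),1)$), and the $j$-th particle started at $x$ is at position $x+S^{(x,j)}_s$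 at time $s$ after its activation. A site $x$ has been visited by an active particle by time $t$ if and only if there is a finite chain of sites $\mathbf{0}=x_0,x_1,\dots,x_k=x$ and used indices $(x_i,j_i)$, $0\le i<k$, such that the sum over $i$ of the first times at which $x_i+S^{(x_i,j_i)}$ hits $x_{i+1}$ is at most $t$. The particles active at time $t$ are exactly the particles whose starting site has been visited by time $t$. By convention $\inf\varnothing=\infty$. *)

(* Defs.v *)
From HB Require Import structures.
From mathcomp Require Import all_boot all_order all_algebra.
From mathcomp Require Import all_classical all_reals all_analysis.

Set Implicit Arguments.
Unset Strict Implicit.
Unset Printing Implicit Defensive.

Set Warnings "-redundant-canonical-projection".

Import Order.TTheory GRing.Theory Num.Theory.
Import numFieldNormedType.Exports.

Local Open Scope classical_set_scope.
Local Open Scope ring_scope.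

(* The lattice Z^d, with the discrete sigma-algebra. *)
Definition site (d : nat) : Type := 'rV[int]_d.

HB.instance Definition _ (d : nat) := GRing.Zmodule.on (site d).
HB.instance Definition _ (d : nat) := Countable.on (site d).
HB.instance Definition _ (d : nat) := isPointed.Build (site d) 0.
HB.instance Definition _ (d : nat) :=
  @isMeasurable.Build default_measure_display (site d) discrete_measurable
    discrete_measurable0 discrete_measurableC discrete_measurableU.

Definition unit_step (d : nat) (v : site d) : bool :=
  \sum_(i < d) `|v ord0 i| == 1.

Definition mutually_independent (dO : measure_display) (O : measurableType dO)
    (R : realType) (P : probability O R) (I : eqType)
    (F : I -> set (set O)) : Prop :=
  forall (s : seq I) (A : I -> set O), uniq s ->
    (forall i, i \in s -> F i (A i)) ->
    P (\bigcap_(i in [set` s]) A i) = (\prod_(i <- s) P (A i))%E.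

(* Laws are compared on measurable sets only: a measure is a function on all
   sets, and its values off the sigma-algebra carry no meaning. *)
Definition has_law (dO : measure_display) (O : measurableType dO)
    (dE : measure_display) (E : measurableType dE) (R : realType)
    (P : probability O R) (X : {RV P >-> E}) (m : set E -> \bar R) : Prop :=
  forall B : set E, measurable B -> distribution P X B = m B.

(* The labels j of the particles and n of the waiting times and jumps start at 0.
   The model is given by the joint law of its ingredients on an arbitrary
   probability space. *)
Record frog_model (R : realType) (d : nat)
    (pi : probability (measurableTypeR R) R) (mu : probability nat R)
    (dO : measure_display) (O : measurableType dO) (P : probability O R) :=
  FrogModel {
  eta : site d -> {RV P >-> nat};
  wait : site d -> nat -> nat -> {RV P >-> measurableTypeR R};
  step : site d -> nat -> nat -> {RV P >-> site d};
  eta_law : forall x, has_law (eta x) mu;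
  wait_law : forall x j n, has_law (wait x j n) pi;
  step_law : forall x j n (v : site d),
    distribution P (step x j n) [set v] =
    (if unit_step v then (2 * d)%N%:R^-1 else 0)%:E;
  frog_independent : mutually_independent P
    (fun i : site d + (site d * nat * nat + site d * nat * nat) =>
       match i with
       | inl x => preimage_set_system setT (eta x) measurable
       | inr (inl (x, j, n)) => preimage_set_system setT (wait x j n) measurable
       | inr (inr (x, j, n)) => preimage_set_system setT (step x j n) measurable
       end)
}.

Section Dynamics.
Variables (R : realType) (d : nat).
Variables (pi : probability (measurableTypeR R) R) (mu : probability nat R).
Variables (dO : measure_display) (O : measurableType dO) (P : probability O R).
Variables (M : frog_model d pi mu P) (w : O).

Definition jump_time (x : site d) (j n : nat) : R :=
  \sum_(i < n) (wait M x j i w : R).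

(* The n below is unique when the waiting times are positive; it fails to exist
   only if infinitely many jumps occur in a bounded time. Both exceptions have
   probability zero, so the default value 0 is irrelevant. *)
Definition jumps_by (x : site d) (j : nat) (t : R) : nat :=
  xget 0%N [set n | jump_time x j n <= t < jump_time x j n.+1].

Definition walk (x : site d) (j : nat) (t : R) : site d :=
  \sum_(i < jumps_by x j t) step M x j i w.

Definition hitting_time (x : site d) (j : nat) (y : site d) : \bar R :=
  ereal_inf [set t%:E | t in [set t : R | 0 <= t /\ x + walk x j t = y]].

(* At the origin one particle is added when eta is 0 there. *)
Definition used (x : site d) (j : nat) : Prop :=
  (j < if x == 0%R then maxn (eta M x w) 1 else eta M x w)%N.

Definition visited_by (t : R) (y : site d) : Prop :=
  exists (k : nat) (x : nat -> site d) (j : nat -> nat),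
    [/\ x 0%N = 0, x k = y, forall i, (i < k)%N -> used (x i) (j i) &
        (\sum_(i < k) hitting_time (x i) (j i) (x i.+1) <= t%:E)%E].

Definition active (t : R) : set (site d * nat) :=
  [set p | used p.1 p.2 /\ visited_by t p.1].

Definition explosion_time : \bar R :=
  ereal_inf [set t%:E | t in [set t : R | 0 <= t /\ infinite_set (active t)]].

End Dynamics.

(* Main.v *)
From HB Require Import structures.
Require Import Defs.
From mathcomp Require Import all_boot all_order all_algebra.
From mathcomp Require Import all_classical all_reals all_analysis.
From mathcomp Require Import lra zify.

(* Let mu put positive mass q_n on N_n, where N_n grows fast enough, and let e be a
   coordinate direction. Frogs at a site with N_n frogs are numerous enough for one
   of them to make L_n quick steps along e within time 2^-n, and the ray of L_n
   sites it follows is long enough to contain a site with N_(n+1) frogs. The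
   failure probabilities are summable even when this is required at once of all
   sites of a deterministic box of radius D_n, so no conditioning on the random
   chain of sites is needed. As D_n may be chosen before N_n, and the lengths in
   the search of the first frog (which makes arbitrarily long straight runs, hence
   meets a site with N_n frogs) depend only on q_n, there is no circularity.
   Borel-Cantelli starts the cascade at some level n0, and then it visits
   infinitely many sites in additional time at most 2. *)

Set Implicit Arguments.
Unset Strict Implicit.
Unset Printing Implicit Defensive.

Import Order.TTheory GRing.Theory Num.Theory.
Import numFieldNormedType.Exports.

Local Open Scope classical_set_scope.
Local Open Scope ring_scope.

(** * Intersections over finite lists *)

Lemma bigcap_set_cons (T : Type) (I : eqType) (i : I) (s : seq I)
    (A : I -> set T) :
  \bigcap_(k in [set` i :: s]) A k = A i `&` \bigcap_(k in [set` s]) A k.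
Proof.
apply/seteqP; split => w /=.
  by move=> H; split => [|k /= ks]; apply: H; rewrite /= inE ?eqxx ?ks ?orbT.
by move=> [Ai H] k /=; rewrite inE => /predU1P[->//|ks]; exact: H.
Qed.

Lemma bigcap_set_nil (T : Type) (I : eqType) (A : I -> set T) :
  \bigcap_(k in [set` ([::] : seq I)]) A k = setT.
Proof. by apply/seteqP; split. Qed.

Lemma bigcap_set_cat (T : Type) (I : eqType) (s t : seq I) (A : I -> set T) :
  \bigcap_(k in [set` s ++ t]) A k =
  \bigcap_(k in [set` s]) A k `&` \bigcap_(k in [set` t]) A k.
Proof.
elim: s => [|i s IH] /=; first by rewrite bigcap_set_nil setTI.
by rewrite !bigcap_set_cons IH setIA.
Qed.

Lemma measurable_bigcap_seq (d : measure_display) (T : measurableType d)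
    (I : eqType) (s : seq I) (A : I -> set T) :
  (forall i, i \in s -> measurable (A i)) ->
  measurable (\bigcap_(i in [set` s]) A i).
Proof.
elim: s => [|i s IH] mA; first by rewrite bigcap_set_nil; exact: measurableT.
rewrite bigcap_set_cons; apply: measurableI; first by apply: mA; rewrite mem_head.
by apply: IH => k ks; apply: mA; rewrite inE ks orbT.
Qed.

(** * Failure probabilities, Borel-Cantelli and discrete conditioning *)

Section Probability.
Context {dO : measure_display} {O : measurableType dO} {R : realType}.
Variable P : probability O R.

Let fineP (A : set O) : measurable A -> P A = (fine (P A))%:E.
Proof. by move=> mA; rewrite fineK// fin_num_measure. Qed.

(** Bounds the outer probability of the complement of [Q], so that events with quantifiers over
    frogs and sites need no measurability proof. *)
Definition fails_below (Q : set O) (c : R) : Prop :=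
  exists S, [/\ measurable S, (P S <= c%:E)%E & ~` S `<=` Q].

Lemma fails_belowW (Q Q' : set O) (c c' : R) :
  Q `<=` Q' -> c <= c' -> fails_below Q c -> fails_below Q' c'.
Proof.
move=> QQ' cc' [S [mS Sc SQ]]; exists S; split => //.
  by apply: (le_trans Sc); rewrite lee_fin.
exact: subset_trans QQ'.
Qed.

Lemma fails_belowI (Q Q' : set O) (c c' : R) :
  fails_below Q c -> fails_below Q' c' -> fails_below (Q `&` Q') (c + c').
Proof.
move=> [S [mS Sc SQ]] [S' [mS' Sc' SQ']]; exists (S `|` S'); split.
- exact: measurableU.
- apply: (@le_trans _ _ (P S + P S')%E); last by rewrite EFinD leeD.
  exact: measureU2.
- by move=> w /not_orP[/SQ Qw /SQ' Q'w].
Qed.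

Lemma fails_below_all (I : eqType) (s : seq I) (Q : I -> set O) (c : R) :
  (forall i, i \in s -> fails_below (Q i) c) ->
  fails_below [set w | forall i, i \in s -> Q i w] ((size s)%:R * c).
Proof.
elim: s => [|i s IH] H.
  by exists set0; split => //; rewrite measure0 mul0r.
have := fails_belowI (H i (mem_head _ _))
  (IH (fun k ks => H k (mem_behead (s := i :: s) ks))).
apply: fails_belowW; last by rewrite -[size (i :: s)]/(size s).+1 -natr1 mulrDl mul1r addrC.
by move=> w [Qi Qs] k; rewrite inE => /predU1P[->//|]; exact: Qs.
Qed.

(** Borel-Cantelli applied to measurable covers [S n] of the complements, whose probabilities are
    dominated by a geometric series. *)
Lemma fails_below_eventually (Q : nat -> set O) (c : R) :
  (forall n, fails_below (Q n) (c * 2^-1 ^+ n)) ->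
  {ae P, forall w, exists n0, forall n, (n0 <= n)%N -> Q n w}.
Proof.
move=> /choice[S HS].
have mS n : measurable (S n) by case: (HS n).
have S0 : P (lim_sup_set S) = 0%E.
  apply: lim_sup_set_cvg0 => //.
  have c0 : 0 <= c.
    have [_ Sc _] := HS 0%N; move: Sc; rewrite expr0 mulr1 => Sc.
    by rewrite -lee_fin (le_trans _ Sc).
  apply: (@le_lt_trans _ _ (\sum_(n <oo) (c * 2^-1 ^+ n)%:E)%E).
    by apply: lee_nneseries => // n _; case: (HS n).
  rewrite (eq_eseriesr (g := fun n => ((c * 2) / (2 ^ n.+1)%:R)%:E)).
    apply: le_lt_trans (ltry (c * 2)).
    by apply: epsilon_trick0; rewrite mulr_ge0.
  move=> n _; congr EFin; rewrite natrX exprS invfM mulrA mulfK ?pnatr_eq0//.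
  by rewrite exprVn.
exists (lim_sup_set S); split => //.
  by apply: bigcap_measurable => // n _; exact: bigcup_measurable.
move=> w /= nQ; apply: contrapT => nS; apply: nQ.
have [n0 Hn0] : exists n0, ~ (\bigcup_(j >= n0) S j) w.
  by apply/existsNP => H; apply: nS => n _; exact: H.
exists n0 => n n0n; have [_ _] := HS n; apply => Sn.
by apply: Hn0; exists n.
Qed.

Lemma ae_forall_countable (T : countType) (Q : T -> O -> Prop) :
  (forall t, {ae P, forall w, Q t w}) -> {ae P, forall w, forall t, Q t w}.
Proof.
move=> aeQ.
pose F k := if @unpickle T k is Some t then ~` Q t else set0.
have : P.-negligible (\bigcup_k F k).
  apply: negligible_bigcup => k; rewrite /F.
  by case: unpickle => [t|]; [exact: aeQ|exact: negligible_set0].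
apply: negligibleS => w /= /existsNP[t nQ].
by exists (pickle t) => //; rewrite /F pickleK.
Qed.

(** Total probability over the fibres of [X]. The conditional bound is stated in product form, so
    values of probability zero need no separate care. *)
Lemma discrete_conditioning (T : countType) (X : O -> T) (E : T -> set O)
    (r : R) :
  0 <= r ->
  (forall t, measurable (X @^-1` [set t])) ->
  (forall t, measurable (E t)) ->
  (forall t, (P (X @^-1` [set t] `&` E t) <= r%:E * P (X @^-1` [set t]))%E) ->
  measurable [set w | E (X w) w] /\ (P [set w | E (X w) w] <= r%:E)%E.
Proof.
move=> r0 mX mE rE.
(* [pickle_inv] is injective where it is defined, hence distinct codes give disjoint fibres. *)
pose G k := if @pickle_inv T k is Some t then X @^-1` [set t] else set0.
pose H k := if @pickle_inv T k is Some t then X @^-1` [set t] `&` E t else set0.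
have mG k : measurable (G k) by rewrite /G; case: (pickle_inv k).
have mH k : measurable (H k).
  by rewrite /H; case: (pickle_inv k) => // t; exact: measurableI.
have -> : [set w | E (X w) w] = \bigcup_k H k.
  apply/seteqP; split => w /=.
    by move=> EX; exists (pickle (X w)) => //; rewrite /H pickleK_inv; split.
  by move=> [k _]; rewrite /H; case: (pickle_inv k) => // t [<-].
have mU : measurable (\bigcup_k H k) by exact: bigcupT_measurable.
split => //.
have HB : (P (\bigcup_k H k) <= \sum_(k <oo) P (H k))%E.
  exact: generalized_Boole_inequality.
apply: (le_trans HB).
apply: (@le_trans _ _ (\sum_(k <oo) (r%:E * P (G k))))%E.
  apply: lee_nneseries => [k _ _|k _]; first exact: measure_ge0.
  rewrite /H /G; case: (pickle_inv k) => [t|]; first exact: rE.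
  by rewrite measure0 mule0.
rewrite nneseriesZl//.
have tG : trivIset setT G.
  move=> i j _ _ [w []]; rewrite /G.
  case Ei: (pickle_inv i) => [t|//]; case Ej: (pickle_inv j) => [t'|//] /= Xt Xt'.
  have := @pickle_invK T i; have := @pickle_invK T j.
  by rewrite Ei Ej /= -Xt -Xt' => <- <-.
have -> : (\sum_(k <oo) P (G k) = P (\bigcup_k G k))%E.
  by rewrite measure_bigcup//; apply: eq_eseriesl => k; rewrite in_setT.
apply: (@le_trans _ _ (r%:E * 1)%E); last by rewrite mule1.
apply: lee_pmul => //.
by apply: probability_le1; exact: bigcupT_measurable.
Qed.

(** * Independent blocks of events *)

Section Independence.
Context (I : eqType) (F : I -> set (set O)).
Hypothesis indepF : mutually_independent P F.
Hypothesis measF : forall i A, F i A -> measurable A.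

(* Induction on [b]: a complement is a difference of two events having one block
   less. *)
Lemma independent_blocks (A : I -> set O) (t : seq I) (b : seq (seq I)) :
  (forall i, F i (A i)) -> uniq (t ++ flatten b) ->
  P (\bigcap_(i in [set` t]) A i `&`
     \bigcap_(s in [set` b]) ~` \bigcap_(i in [set` s]) A i) =
  (\prod_(i <- t) fine (P (A i)) *
   \prod_(s <- b) (1 - \prod_(i <- s) fine (P (A i))))%:E.
Proof.
move=> FA; have mA i : measurable (A i) by exact: measF (FA i).
elim: b t => [|s b IH] t /=.
  rewrite cats0 bigcap_set_nil setIT big_nil mulr1 => ut.
  rewrite indepF// (big_morph EFin (@EFinM R) erefl).
  by apply: eq_bigr => i _; exact: fineP.
move=> u.
have ut : uniq (t ++ flatten b).
  move: u; rewrite uniq_catCA cat_uniq => /and3P[_ _].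
  by rewrite uniq_catC.
have uts : uniq ((t ++ s) ++ flatten b) by rewrite -catA.
rewrite bigcap_set_cons.
set T := \bigcap_(i in [set` t]) A i; set S := \bigcap_(i in [set` s]) A i.
set B := \bigcap_(i in [set` b]) _.
have mT : measurable T by exact: measurable_bigcap_seq.
have mS : measurable S by exact: measurable_bigcap_seq.
have mB : measurable B.
  apply: measurable_bigcap_seq => k _; apply: measurableC.
  exact: measurable_bigcap_seq.
have -> : T `&` (~` S `&` B) = (T `&` B) `\` S by rewrite setDE setIAC setIA.
have -> : P ((T `&` B) `\` S) = (P (T `&` B) - P (T `&` B `&` S))%E.
  apply: measureD => //; first exact: measurableI.
  by rewrite -ge0_fin_numE// fin_num_measure//; exact: measurableI.
have -> : T `&` B `&` S = (T `&` S) `&` B by rewrite setIAC.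
rewrite /T /S /B -bigcap_set_cat (IH t ut) (IH _ uts) -EFinB; congr EFin.
by rewrite big_cat big_cons /= -mulrA -mulrBr mulrBl mul1r.
Qed.

End Independence.
End Probability.

Lemma geometric_small (R : realType) (c r eps : R) :
  0 <= r < 1 -> 0 < eps -> exists n, c * r ^+ n <= eps.
Proof.
move=> /andP[r0 r1] eps0.
have : geometric c r @ \oo --> (0 : R).
  by apply: cvg_geometric; rewrite ger0_norm.
move=> /cvgr0Pnorm_le /(_ eps eps0) [n _ /(_ n (leqnn n))] /= H.
by exists n; apply: le_trans H; exact: ler_norm.
Qed.

(** * Boxes and rays in the lattice *)

Section Site.
Context {d : nat}.
Implicit Types (x y v : site d) (i : 'I_d).

Lemma site_addE x y i : (x + y) ord0 i = x ord0 i + y ord0 i.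
Proof. exact: mxE. Qed.

Lemma site_sumE n (f : 'I_n -> site d) i :
  (\sum_(k < n) f k) ord0 i = \sum_(k < n) f k ord0 i.
Proof. exact: summxE. Qed.

(** The sup-norm ball of radius [n] about 0, given as a list so that its size is the factor in a
    union bound. *)
Definition box (n : nat) : seq (site d) :=
  [seq (\row_i ((f i : nat)%:Z - n%:Z) : site d)
  | f : {ffun 'I_d -> 'I_(n.*2.+1)} <- enum {: {ffun 'I_d -> 'I_(n.*2.+1)}}].

Lemma mem_box n x : (x \in box n) = [forall i, `|x ord0 i| <= n%:Z].
Proof.
apply/mapP/forallP => [[f _ ->] i|H].
  by rewrite mxE; move: (nat_of_ord _) (ltn_ord (f i)) => k; lia.
exists [ffun i => inord `|(x ord0 i + n%:Z)%R|%N]; first by rewrite mem_enum.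
apply/rowP => i; move: (H i); rewrite mxE ffunE.
by move: (x _ _) => z zn; rewrite inordK; lia.
Qed.

Lemma unit_step_le1 v i : unit_step v -> `|v ord0 i| <= 1.
Proof.
move=> /eqP <-; rewrite (bigD1 i)//= lerDl.
by apply: sumr_ge0 => k _.
Qed.

Lemma sum_steps_mem_box n (f : 'I_n -> site d) :
  (forall k, unit_step (f k)) -> \sum_(k < n) f k \in box n.
Proof.
move=> uf; rewrite mem_box; apply/forallP => i; rewrite site_sumE.
apply: (le_trans (ler_norm_sum _ _ _)).
apply: (@le_trans _ _ (\sum_(k < n) 1)).
  by apply: ler_sum => k _; exact: unit_step_le1.
by rewrite sumr_const card_ord natz.
Qed.

Lemma le_box m n x : (m <= n)%N -> x \in box m -> x \in box n.
Proof.
rewrite !mem_box => mn /forallP H; apply/forallP => i; by have := H i; move: (x _ _) => z; lia.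
Qed.

Definition direction i : site d := \row_k (k == i)%:Z.

Lemma directionE i k : direction i ord0 k = (k == i)%:Z.
Proof. exact: mxE. Qed.

Lemma unit_step_direction i : unit_step (direction i).
Proof.
apply/eqP; rewrite (bigD1 i)//= directionE eqxx big1 ?addr0// => k ki.
by rewrite directionE (negbTE ki).
Qed.

Lemma direction_mulrn i k n : (direction i *+ n) ord0 k = ((k == i) * n)%N%:Z.
Proof.
elim: n => [|n IH]; first by rewrite mulr0n muln0; exact: mxE.
by rewrite mulrS site_addE IH directionE; lia.
Qed.

Lemma add_direction_mem_box m n i x l : (l < n)%N ->
  x \in box m -> x + direction i *+ l.+1 \in box (m + n).
Proof.
rewrite !mem_box => ln /forallP H; apply/forallP => k.
rewrite site_addE direction_mulrn; by have := H k; move: (x _ _) => z; case: (k == i); lia.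
Qed.

Lemma direction_ray_inj i x : injective (fun l => x + direction i *+ l).
Proof.
move=> k l /= /(congr1 (fun y : site d => y ord0 i)).
by rewrite !site_addE !direction_mulrn eqxx; lia.
Qed.

End Site.

(** * Choice of the scales *)

(* [D] bounds the region reached, [L] the length of the rays followed and [N]
   the number of frogs used at each scale; [K] and [W] give the length and the
   number of the blocks of steps of the first frog. *)
Lemma cascade_parameters (R : realType) (d : nat) (u : R) (q : nat -> R)
    (p : nat -> nat -> R) :
  0 < u <= 1 -> (forall n, 0 < q n <= 1) -> (forall n l, 0 < p n l <= 1) ->
  exists K W D L N : nat -> nat, forall n,
  [/\ (1 - q n) ^+ K n <= 2^-1 ^+ n,
      (1 - u ^+ K n) ^+ W n <= 2^-1 ^+ n,
      (W n * K n <= D n)%N /\ (D n + L n <= D n.+1)%N,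
      (size (@box d (D n)))%:R * (1 - q n.+1) ^+ L n <= 2^-1 ^+ n &
      (size (@box d (D n)))%:R * (1 - p n (L n)) ^+ N n <= 2^-1 ^+ n].
Proof.
move=> u01 q01 p01.
have small (c r : R) n : 0 < r <= 1 -> exists m, c * (1 - r) ^+ m <= 2^-1 ^+ n.
  by move=> r01; apply: geometric_small; [lra|rewrite exprn_gt0// invr_gt0].
have /choice[K HK] : forall n, exists k, (1 - q n) ^+ k <= 2^-1 ^+ n.
  by move=> n; have [k] := small 1 _ n (q01 n); exists k; rewrite -[leLHS]mul1r.
have /choice[W HW] : forall n, exists k, (1 - u ^+ K n) ^+ k <= 2^-1 ^+ n.
  move=> n; have [|k] := small 1 (u ^+ K n) n.
    by have [? ?] := andP u01; rewrite exprn_gt0//= exprn_ile1// ltW.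
  by exists k; rewrite -[leLHS]mul1r.
(* [L], and then [N], is first chosen for every pair of a level and a radius; the recursion for [D]
   afterwards selects the radius. *)
have /choice[L HL] : forall nb : nat * nat, exists k,
    (size (@box d nb.2))%:R * (1 - q nb.1.+1) ^+ k <= 2^-1 ^+ nb.1.
  by move=> nb; exact: small.
have /choice[N HN] : forall nb : nat * nat, exists k,
    (size (@box d nb.2))%:R * (1 - p nb.1 (L nb)) ^+ k <= 2^-1 ^+ nb.1.
  by move=> nb; exact: small.
(* The next radius makes room both for a ray issued from the current box and for the search of the
   first frog at the next level. *)
pose D := fix D n := if n is m.+1 then (D m + L (m, D m) + W n * K n)%N
                     else (W 0 * K 0)%N.
exists K, W, D, (fun n => L (n, D n)), (fun n => N (n, D n)) => n; split => //.
- split; last by rewrite /= leq_addr.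
  by case: n => [//|n] /=; rewrite leq_addl.
- exact: (HL (n, D n)).
- exact: (HN (n, D n)).
Qed.

(** * Pathwise dynamics: chains of visits and the cascade *)

Section Dynamics.
Context {R : realType} {d : nat}.
Context { pi : probability (measurableTypeR R) R} {mu : probability nat R}.
Context {dO : measure_display} {O : measurableType dO} {P : probability O R}.
Variables (M : frog_model d pi mu P) (w : O).
Implicit Types (x y : site d) (j n : nat).

(** A single site: the position after [n] jumps, irrespective of the jump times. *)
Definition walk_range x j n : site d :=
  x + \sum_(i < n) step M x j i w.

Hypothesis wait_gt0 : forall x j n, (0 : R) < wait M x j n w.

Lemma jump_timeS x j n :
  jump_time M w x j n.+1 = jump_time M w x j n + wait M x j n w.
Proof. by rewrite /jump_time big_ord_recr. Qed.

Lemma lt_jump_time x j : {homo jump_time M w x j : m n / (m < n)%N >-> m < n}.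
Proof.
by apply: homo_ltn => [y x' z|n]; [exact: lt_trans|rewrite jump_timeS ltrDl].
Qed.

Lemma jump_time_ge0 x j n : 0 <= jump_time M w x j n.
Proof. by apply: sumr_ge0 => i _; exact/ltW/wait_gt0. Qed.

(** Positive waiting times make the jump times strictly increasing, so [n] is the only candidate for
    [xget] and the default value does not occur. *)
Lemma jumps_by_jump_time x j n :
  jumps_by M w x j (jump_time M w x j n) = n.
Proof.
rewrite /jumps_by; case: xgetP => [m _ /= /andP[mn nm]|/(_ n)]; last first.
  by rewrite /= lexx (lt_jump_time x j (ltnSn n)).
case: (ltngtP m n) => // [lt|lt].
- have : jump_time M w x j m.+1 <= jump_time M w x j n.
    by move: lt; rewrite leq_eqVlt => /predU1P[->//|/(lt_jump_time x j)/ltW].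
  by rewrite leNgt nm.
- by have := lt_jump_time x j lt; rewrite ltNge mn.
Qed.

Lemma hitting_time_le x j n (s : R) : jump_time M w x j n <= s ->
  (hitting_time M w x j (walk_range x j n) <= s%:E)%E.
Proof.
move=> ns; apply: (@le_trans _ _ (jump_time M w x j n)%:E); last by rewrite lee_fin.
apply: ereal_inf_lbound; exists (jump_time M w x j n) => //; split.
  exact: jump_time_ge0.
by rewrite /walk jumps_by_jump_time.
Qed.

Lemma visited_by_le (s t : R) y : s <= t ->
  visited_by M w s y -> visited_by M w t y.
Proof.
move=> st [k [x [j [x0 xk u S]]]]; exists k, x, j; split => //.
by apply: (le_trans S); rewrite lee_fin.
Qed.

Lemma visited_by_origin : visited_by M w 0 0.
Proof. by exists 0%N, (fun=> 0), (fun=> 0%N); split => //; rewrite big_ord0. Qed.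

(** The chain that reaches [x] is prolonged by one hop, made by frog [j] from [x] to [y]. *)
Lemma visited_by_next (t s : R) x y j : visited_by M w t x -> used M w x j ->
  (hitting_time M w x j y <= s%:E)%E -> visited_by M w (t + s) y.
Proof.
move=> [k [z [l [z0 zk u S]]]] xj xy.
exists k.+1, (fun i => if (i <= k)%N then z i else y),
  (fun i => if (i < k)%N then l i else j); split => //.
- by rewrite ltnn.
- move=> i; rewrite ltnS; case: (ltngtP i k) => // [ik _|-> _]; first exact: u.
  by rewrite zk.
- rewrite big_ord_recr /= leqnn !ltnn zk EFinD; apply: leeD => //.
  rewrite [leLHS](_ : _ = \sum_(i < k) hitting_time M w (z i) (l i) (z i.+1))%E//.
  by apply: eq_bigr => -[i ik] _ /=; rewrite ik (ltnW ik).
Qed.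

Lemma explosion_time_fin (t : R) : 0 <= t -> infinite_set (active M w t) ->
  (explosion_time M w < +oo)%E.
Proof.
move=> t0 inf; apply: (@le_lt_trans _ _ t%:E); last exact: ltry.
by apply: ereal_inf_lbound; exists t.
Qed.

Lemma used_eta x j : (j < eta M x w)%N -> used M w x j.
Proof. by rewrite /used; case: ifP => // _ /leq_trans; apply; exact: leq_maxl. Qed.

Lemma used_origin : used M w 0 0.
Proof. by rewrite /used eqxx leq_max orbT. Qed.

Variable i0 : 'I_d.

Definition straight x j n : Prop :=
  forall i, (i < n)%N -> step M x j i w = direction i0.

Lemma straight_walk_range x j n l : straight x j n -> (l <= n)%N ->
  walk_range x j l = x + direction i0 *+ l.
Proof.
move=> st ln; rewrite /walk_range; congr (x + _).
rewrite (eq_bigr (fun=> direction i0)); last by move=> i _; apply: st; have := ltn_ord i; lia.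
by rewrite sumr_const card_ord.
Qed.

(** The deterministic half of the argument, at a fixed sample point: at each level a quick straight
    frog carries the activation from a rich site to a rich site of the next level. *)
Lemma cascade_explosion (D L N : nat -> nat) n0 (t : R) x0 :
  (forall n, (n0 <= n)%N -> (D n + L n <= D n.+1)%N) ->
  (forall n x, (n0 <= n)%N -> x \in box (D n) ->
     exists l, (l < L n)%N /\ eta M (x + direction i0 *+ l.+1) w = N n.+1) ->
  (forall n x, (n0 <= n)%N -> x \in box (D n) ->
     exists j, [/\ (j < N n)%N, straight x j (L n) &
       jump_time M w x j (L n) <= 2^-1 ^+ n]) ->
  0 <= t -> x0 \in box (D n0) -> eta M x0 w = N n0 -> visited_by M w t x0 ->
  (explosion_time M w < +oo)%E.
Proof.
move=> DL rich quick t0 x0D x0N x0t.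
(* The first [m] hops take at most the sum of [2^-i] over [i < m], which is [2 - 2 * 2^-m]. The
   growth of the coordinate [i0] forces infinitely many distinct sites. *)
have chain m : exists x, [/\ x \in box (D (n0 + m)%N), eta M x w = N (n0 + m)%N,
    visited_by M w (t + 2 - 2 * 2^-1 ^+ m) x &
    x0 ord0 i0 + m%:Z <= x ord0 i0].
  elim: m => [|m [x [xD xN xt xm]]].
    by exists x0; rewrite !addn0 expr0 mulr1 addrK; split => //; rewrite addr0.
  have [l [lL yN]] := rich _ x (leq_addr _ _) xD.
  have [j [jN jst jt]] := quick _ x (leq_addr _ _) xD.
  exists (x + direction i0 *+ l.+1); rewrite addnS; split => //.
  - apply: le_box (DL _ (leq_addr _ _)) _; exact: add_direction_mem_box.
  - have -> : t + 2 - 2 * 2^-1 ^+ m.+1 = t + 2 - 2 * 2^-1 ^+ m + 2^-1 ^+ m :> R.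
      by rewrite exprS; lra.
    apply: (visited_by_next xt (used_eta _)); first by rewrite xN; exact: jN.
    rewrite -(straight_walk_range jst lL); apply: hitting_time_le.
    have : jump_time M w x j l.+1 <= jump_time M w x j (L (n0 + m)%N).
      by move: lL; rewrite leq_eqVlt => /predU1P[->//|/(lt_jump_time x j)/ltW].
    move=> /le_trans; apply; apply: (le_trans jt).
    (* The hop at level [n0 + m] has the budget [2^-(n0 + m)], at most the [2^-m] allotted to it. *)
    by rewrite ler_wiXn2l ?leq_addl//; lra.
  - rewrite site_addE direction_mulrn eqxx mul1n.
    by move: (x _ _) (x0 _ _) xm => a b; lia.
apply: (@explosion_time_fin (t + 2)); first by lra.
move=> /finite_seqP[s sE].
(* If only finitely many particles were active, their displacements along [i0] would be bounded, yet
   the chain goes beyond any bound. *)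
pose dist (p : site d * nat) := `|(p.1 ord0 i0 - x0 ord0 i0)%R|%N.
have [x [xD xN xt xm]] := chain (\max_(p <- s) dist p).+1.
have : (x, 0%N) \in s.
  suff : active M w (t + 2) (x, 0%N) by rewrite sE.
  split; last first.
    by apply: visited_by_le xt; rewrite lerBlDr lerDl mulr_ge0// exprn_ge0//; lra.
  (* The existence of some [j] below [N] shows that the site is occupied, so its particle 0 is
     used. *)
  have [j [jN _ _]] := quick _ x (leq_addr _ _) xD.
  by apply: used_eta; rewrite xN (leq_ltn_trans _ jN).
move=> /(@leq_bigmax_seq _ _ xpredT dist) /(_ isT).
move: (\max_(_ <- _) _) xm => m; rewrite /dist /=.
by move: (x _ _) (x0 _ _) => a b; lia.
Qed.

End Dynamics.

(** * Products over lists *)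

Section ProdSeq.
Context {R : realType} {I : eqType}.
Implicit Types (s : seq I) (f : I -> R) (c : R).

Lemma prod_seq_const s f c : (forall i, i \in s -> f i = c) ->
  \prod_(i <- s) f i = c ^+ size s.
Proof.
by move=> fc; rewrite (eq_big_seq _ fc) big_const_seq count_predT iter_mulr_1.
Qed.

Lemma prod_seq_le s f c : (forall i, i \in s -> 0 <= f i <= c) ->
  \prod_(i <- s) f i <= c ^+ size s.
Proof.
move=> H; rewrite -(@prod_seq_const s (fun=> c))//.
by rewrite !big_seq; exact: ler_prod.
Qed.

End ProdSeq.

(** * Probability estimates for the frog model *)

Section Model.
Context {R : realType} {d : nat}.
Context { pi : probability (measurableTypeR R) R} {mu : probability nat R}.
Context {dO : measure_display} {O : measurableType dO} {P : probability O R}.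
Variable M : frog_model d pi mu P.
Variable i0 : 'I_d.
Implicit Types (x y : site d) (j n : nat).

Definition source : eqType :=
  (site d + (site d * nat * nat + site d * nat * nat))%type.

Definition source_events (i : source) : set (set O) :=
  match i with
  | inl x => preimage_set_system setT (eta M x) measurable
  | inr (inl (x, j, n)) => preimage_set_system setT (wait M x j n) measurable
  | inr (inr (x, j, n)) => preimage_set_system setT (step M x j n) measurable
  end.

(** One event for each source of randomness, so that a finite event is described by the list of
    sources it constrains. The set for a step may depend on [n], which allows a whole initial path
    to be prescribed. *)
Definition constraint (h : set nat) (g : set R) (s : nat -> set (site d))
    (i : source) : set O :=
  match i with
  | inl x => eta M x @^-1` h
  | inr (inl (x, j, n)) => wait M x j n @^-1` g
  | inr (inr (x, j, n)) => step M x j n @^-1` s n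
  end.

Lemma source_events_measurable i A : source_events i A -> measurable A.
Proof.
by case: i => [x|[[[x j] n]|[[x j] n]]] [B mB <-]; exact: measurable_funP.
Qed.

Lemma constraint_events h (g : set (measurableTypeR R)) s i :
  measurable g -> source_events i (constraint h g s i).
Proof.
move=> mg; case: i => [x|[[[x j] n]|[[x j] n]]] /=.
- by exists h; rewrite // setTI.
- by exists g; rewrite // setTI.
- by exists (s n); rewrite // setTI.
Qed.

Lemma measurable_constraint h (g : set (measurableTypeR R)) s i :
  measurable g -> measurable (constraint h g s i).
Proof. by move=> mg; exact: source_events_measurable (constraint_events _ _ _ mg). Qed.

Lemma prob_eta x h : P (eta M x @^-1` h) = mu h.
Proof. exact: eta_law. Qed.

Lemma prob_wait x j n (g : set (measurableTypeR R)) :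
  measurable g -> P (wait M x j n @^-1` g) = pi g.
Proof. exact: wait_law. Qed.

Lemma prob_step_direction x j n :
  P (step M x j n @^-1` [set direction i0]) = ((2 * d)%N%:R^-1)%:E.
Proof.
by have := step_law M x j n (direction i0); rewrite unit_step_direction.
Qed.

Lemma constraint_blocks h (g : set (measurableTypeR R)) s
    (t : seq source) (b : seq (seq source)) :
  measurable g -> uniq (t ++ flatten b) ->
  P (\bigcap_(i in [set` t]) constraint h g s i `&`
     \bigcap_(r in [set` b]) ~` \bigcap_(i in [set` r]) constraint h g s i) =
  (\prod_(i <- t) fine (P (constraint h g s i)) *
   \prod_(r <- b) (1 - \prod_(i <- r) fine (P (constraint h g s i))))%:E.
Proof.
move=> mg ub; apply: (@independent_blocks _ _ _ P source source_events) => //.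
- exact: (@frog_independent _ _ _ _ _ _ _ M).
- exact: source_events_measurable.
- by move=> i; exact: constraint_events.
Qed.

Lemma prob_not_eta x N (q : R) : (q%:E <= mu [set N])%E ->
  0 <= fine (P (eta M x @^-1` (~` [set N]))) <= 1 - q.
Proof.
move=> qN; rewrite prob_eta; apply/andP; split; first exact: fine_ge0.
rewrite -lee_fin fineK ?fin_num_measure// probability_setC// EFinB.
by apply: leeB.
Qed.

(** The sites of a ray are distinct, so their occupation numbers are independent, and each one
    misses [N] with probability at most [1 - q]. *)
Lemma ray_rich x n N (q : R) : (q%:E <= mu [set N])%E ->
  fails_below P
    [set w | exists l, (l < n)%N /\ eta M (x + direction i0 *+ l.+1) w = N]
    ((1 - q) ^+ n).
Proof.
move=> qN.
pose t : seq source := [seq inl (x + direction i0 *+ l.+1) | l <- iota 0 n].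
exists (\bigcap_(i in [set` t]) constraint (~` [set N]) setT (fun=> setT) i).
split.
- by apply: measurable_bigcap_seq => i _; exact: measurable_constraint.
- have ut : uniq (t ++ flatten [::]).
    rewrite cats0 map_inj_uniq ?iota_uniq// => k l [/direction_ray_inj].
    by case.
  have := constraint_blocks (~` [set N]) (fun=> setT) measurableT ut.
  rewrite bigcap_set_nil setIT big_nil mulr1 => ->.
  rewrite lee_fin -[X in _ ^+ X](size_iota 0) -(size_map (fun l =>
    inl (x + direction i0 *+ l.+1) : source)).
  by apply: prod_seq_le => i /mapP[l _ ->]; exact: prob_not_eta.
- move=> w /= nE; apply: contrapT => nex; apply: nE => i /=.
  move=> /mapP[l]; rewrite mem_iota => ln -> /= lN; apply: nex.
  by exists l.
Qed.

(** The first [n] waits and [n] steps of each frog form a block of [2n] sources. Different frogs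
    have disjoint blocks, so the failures of the [m] frogs multiply. *)
Lemma quick_straight_frog x n m (delta : R) :
  fails_below P
    [set w | exists j, [/\ (j < m)%N, straight M w i0 x j n &
      forall k, (k < n)%N -> wait M x j k w <= delta]]
    ((1 - ((2 * d)%N%:R^-1 * fine (pi [set` `]0%R, delta]])) ^+ n) ^+ m).
Proof.
pose f j (c : nat + nat) : source :=
  match c with inl k => inr (inl (x, j, k)) | inr k => inr (inr (x, j, k)) end.
pose cells : seq (nat + nat) :=
  [seq inl k | k <- iota 0 n] ++ [seq inr k | k <- iota 0 n].
pose b := [seq [seq f j c | c <- cells] | j <- iota 0 m].
pose A := constraint setT [set` `]0%R, delta]] (fun=> [set direction i0]).
have ucells : uniq cells.
  rewrite cat_uniq !map_inj_uniq ?iota_uniq//=; try by move=> ? ? [].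
  by rewrite andbT; apply/hasPn => c /mapP[k _ ->]; apply/negP => /mapP[].
have mg : measurable ([set` `]0%R, delta]] : set (measurableTypeR R)).
  exact: measurable_itv.
exists (\bigcap_(r in [set` b]) ~` \bigcap_(i in [set` r]) A i); split.
- apply: measurable_bigcap_seq => r _; apply: measurableC.
  by apply: measurable_bigcap_seq => i _; exact: measurable_constraint.
- have ub : uniq ([::] ++ flatten b).
    rewrite /= allpairs_uniq ?iota_uniq//.
    by move=> [j [k|k]] [j' [k'|k']] _ _ //= [-> ->].
  have := constraint_blocks setT (fun=> [set direction i0]) mg ub.
  rewrite bigcap_set_nil setTI big_nil mul1r => ->; rewrite lee_fin.
  rewrite (@prod_seq_const _ _ _ _ (1 - ((2 * d)%N%:R^-1 *
    fine (pi [set` `]0%R, delta]])) ^+ n)); first by rewrite size_map size_iota.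
  move=> r /mapP[j _ ->]; congr (1 - _).
  rewrite big_map big_cat /= !big_map mulrC exprMn.
  congr (_ * _); rewrite -[in RHS](size_iota 0 n); apply: prod_seq_const => k _.
    by rewrite /= prob_step_direction.
  by rewrite /= prob_wait.
- move=> w /= nE; apply: contrapT => nex; apply: nE => r /= /mapP[j].
  rewrite mem_iota => jm -> all; apply: nex; exists j; split => //.
  + move=> k kn; apply: (all (f j (inr k))).
    by apply: (@map_f _ _ (f j)); rewrite mem_cat map_f ?orbT// mem_iota.
  + move=> k kn; have : A (f j (inl k)) w.
      by apply: all; apply: (@map_f _ _ (f j)); rewrite mem_cat map_f// mem_iota.
    by rewrite /A /= in_itv /= => /andP[].
Qed.

(** The first [m * n] steps of the first frog are cut into [m] disjoint blocks of length [n], which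
    are independent. *)
Lemma straight_block n m :
  fails_below P
    [set w | exists k : 'I_m, forall l, (l < n)%N ->
      step M 0 0 (k * n + l)%N w = direction i0]
    ((1 - (2 * d)%N%:R^-1 ^+ n) ^+ m).
Proof.
pose b : seq (seq source) :=
  [seq [seq inr (inr (0, 0%N, (k * n + l)%N)) | l <- iota 0 n] | k <- iota 0 m].
pose A := constraint setT setT (fun=> [set direction i0]).
exists (\bigcap_(r in [set` b]) ~` \bigcap_(i in [set` r]) A i); split.
- apply: measurable_bigcap_seq => r _; apply: measurableC.
  by apply: measurable_bigcap_seq => i _; exact: measurable_constraint.
- have ub : uniq ([::] ++ flatten b).
    apply: allpairs_uniq; rewrite ?iota_uniq// => -[k l] [k' l'].
    move=> /allpairsP[[a c] /= [_ + [-> ->]]] /allpairsP[[a' c'] /= [_ + [-> ->]]].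
    rewrite !mem_iota !add0n => /= cn c'n [eq].
    (* Euclidean division by [n] recovers the block and the offset from the index of a step, so no
       step is listed twice. *)
    have [ka la] := (edivn_eq a cn, edivn_eq a' c'n).
    by move: la; rewrite -eq ka => -[-> ->].
  have := constraint_blocks setT (fun=> [set direction i0]) measurableT ub.
  rewrite bigcap_set_nil setTI big_nil mul1r => ->; rewrite lee_fin.
  rewrite (@prod_seq_const _ _ _ _ (1 - (2 * d)%N%:R^-1 ^+ n)).
    by rewrite size_map size_iota.
  move=> r /mapP[k _ ->]; congr (1 - _).
  rewrite big_map -[in RHS](size_iota 0 n); apply: prod_seq_const => l _.
  by rewrite /= prob_step_direction.
- move=> w /= nE; apply: contrapT => nex; apply: nE => r /= /mapP[k].
  rewrite mem_iota => km -> all; apply: nex; exists (Ordinal km) => l ln.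
  apply: (all (inr (inr (0, 0%N, (k * n + l)%N)))).
  by apply/mapP; exists l; rewrite // mem_iota.
Qed.

(** The discrete variable to condition on: it determines the path of the first frog. *)
Definition first_steps n (w : O) : seq (site d) :=
  [seq step M 0 0 k w | k <- iota 0 n].

Lemma first_stepsE n (s : seq (site d)) : size s = n ->
  first_steps n @^-1` [set s] =
  \bigcap_(i in [set` [seq inr (inr (0, 0%N, k)) : source | k <- iota 0 n]])
    constraint setT setT (fun k => [set nth 0 s k]) i.
Proof.
move=> sn; apply/seteqP; split => w /=.
  move=> ws i /= /mapP[k]; rewrite mem_iota => kn -> /=.
  by rewrite -ws (nth_map 0%N) ?size_iota// nth_iota.
move=> H; apply: (@eq_from_nth _ 0); rewrite size_map size_iota// => k kn.
rewrite (nth_map 0%N) ?size_iota// nth_iota// add0n.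
apply: (H (inr (inr (0, 0%N, k)))).
by apply/mapP; exists k; rewrite // mem_iota.
Qed.

(** The two error terms are the absence of a straight block and the absence of [N] along the ray of
    a straight block. Since steps are independent of occupation numbers, it does no harm if the ray
    meets sites seen before. *)
Lemma first_frog_finds n m N (q : R) : q <= 1 -> (q%:E <= mu [set N])%E ->
  fails_below P
    [set w | exists k, (k <= m * n)%N /\ eta M (walk_range M w 0 0 k) w = N]
    ((1 - (2 * d)%N%:R^-1 ^+ n) ^+ m + (1 - q) ^+ n).
Proof.
move=> q1 qN.
(* Given the first [m * n] steps, the occupation numbers along the first straight
   block are still fresh. *)
pose is_straight (s : seq (site d)) (k : 'I_m) :=
  [forall l : 'I_n, nth 0 s (k * n + l) == direction i0].
pose ray (s : seq (site d)) (k : 'I_m) : seq source :=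
  [seq inl (\sum_(i < k * n) nth 0 s i + direction i0 *+ l.+1) | l <- iota 0 n].
(* The bad event for the path [s]. It is empty when [s] has no straight block, since
   [straight_block] accounts for that case. *)
pose E s := if [pick k | is_straight s k] is Some k then
    \bigcap_(i in [set` ray s k])
      constraint (~` [set N]) setT (fun k => [set nth 0 s k]) i
  else set0.
have mE s : measurable (E s).
  rewrite /E; case: pickP => // k _.
  by apply: measurable_bigcap_seq => i _; exact: measurable_constraint.
have mX s : measurable (first_steps (m * n) @^-1` [set s]).
  have [sn|sn] := eqVneq (size s) (m * n)%N.
    rewrite first_stepsE//.
    by apply: measurable_bigcap_seq => i _; exact: measurable_constraint.
  rewrite (_ : _ @^-1` _ = set0)//; apply/seteqP; split => w //= ws.
  by move: sn; rewrite -ws size_map size_iota eqxx.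
have q0 : 0 <= (1 - q) ^+ n by rewrite exprn_ge0// subr_ge0.
have XE s : (P (first_steps (m * n) @^-1` [set s] `&` E s) <=
    ((1 - q) ^+ n)%:E * P (first_steps (m * n) @^-1` [set s]))%E.
  rewrite /E; case: pickP => [k _|_]; last first.
    by rewrite setI0 measure0 mule_ge0.
  have [sn|sn] := eqVneq (size s) (m * n)%N; last first.
    rewrite (_ : _ @^-1` _ = set0) ?set0I ?measure0 ?mule0//.
    apply/seteqP; split => w //= ws.
    by move: sn; rewrite -ws size_map size_iota eqxx.
  set t := [seq inr (inr (0, 0%N, k)) : source | k <- iota 0 (m * n)].
  (* The list [t] holds only steps, so the condition on occupation numbers can be changed at will;
     this puts path and ray under a common constraint. *)
  have XC : first_steps (m * n) @^-1` [set s] = \bigcap_(i in [set` t])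
      constraint (~` [set N]) setT (fun k => [set nth 0 s k]) i.
    rewrite first_stepsE//; apply: eq_bigcapr => i /= /mapP[l _ ->] //.
  have ut : uniq t by rewrite map_inj_uniq ?iota_uniq// => ? ? [].
  have utr : uniq (t ++ ray s k).
    rewrite cat_uniq ut /= map_inj_uniq ?iota_uniq ?andbT.
      by apply/hasPn => i /mapP[l _ ->]; apply/negP => /mapP[].
    by move=> a c [/direction_ray_inj[]].
  have := @constraint_blocks (~` [set N]) _ (fun k => [set nth 0 s k])
    t [::] measurableT.
  rewrite cats0 bigcap_set_nil setIT big_nil mulr1 => /(_ ut) Pt.
  have := @constraint_blocks (~` [set N]) _ (fun k => [set nth 0 s k])
    (t ++ ray s k) [::] measurableT.
  rewrite cats0 bigcap_set_nil setIT big_nil mulr1 => /(_ utr) Ptr.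
  rewrite XC -bigcap_set_cat Pt Ptr -EFinM lee_fin big_cat /= mulrC.
  apply: ler_wpM2r; first by apply: prodr_ge0 => i _; exact: fine_ge0.
  rewrite -[X in _ ^+ X](size_iota 0) -(size_map (fun l =>
    inl (\sum_(i < k * n) nth 0 s i + direction i0 *+ l.+1) : source)).
  by apply: prod_seq_le => i /mapP[l _ ->]; exact: prob_not_eta.
have [mB PB] := discrete_conditioning q0 mX mE XE.
have fB : fails_below P (~` [set w | E (first_steps (m * n) w) w]) ((1 - q) ^+ n).
  by exists [set w | E (first_steps (m * n) w) w]; split; last exact: subset_refl.
apply: fails_belowW (fails_belowI (straight_block n m) fB) => // w [[k kw] nE].
apply: contrapT => nex; apply: nE; rewrite /= /E.
have nthE i : (i < m * n)%N ->
    nth 0 (first_steps (m * n) w) i = step M 0 0 i w.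
  by move=> imn; rewrite (nth_map 0%N) ?size_iota// nth_iota.
have block_lt (k' : 'I_m) l : (l < n)%N -> (k' * n + l < m * n)%N.
  by move=> ln; have := ltn_ord k'; nia.
(* The picked block [k'] may differ from [k]; the block [k] only rules out that none is picked. *)
case: pickP => [k' /forallP st|/(_ k)/negP[]]; last first.
  by apply/forallP => l; rewrite nthE ?kw ?block_lt.
move=> i /= /mapP[l]; rewrite mem_iota => /= ln -> /= lN; apply: nex.
exists (k' * n + l.+1)%N; split; first by rewrite addnS; exact: block_lt.
rewrite -lN; congr (eta M _ w); rewrite /walk_range add0r big_split_ord /=.
congr (_ + _).
  by apply: eq_bigr => i' _; rewrite nthE//; have := ltn_ord i'; have := block_lt k' l ln; lia.
rewrite (eq_bigr (fun=> direction i0)) ?sumr_const ?card_ord// => i' _.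
have i'n : (i' < n)%N by have := ltn_ord i'; lia.
by have /eqP := st (Ordinal i'n); rewrite /= nthE ?block_lt.
Qed.

Lemma ae_regular : pi [set` `]0%R, +oo[] = 1%E ->
  {ae P, forall w, (forall x j n, (0 : R) < wait M x j n w) /\
                   (forall x j n, unit_step (step M x j n w))}.
Proof.
move=> pi_pos.
have W : {ae P, forall w, forall a : site d * nat * nat,
    (0 : R) < wait M a.1.1 a.1.2 a.2 w}.
  apply: ae_forall_countable => -[[x j] n] /=.
  have m0 : measurable ([set` `]0%R, +oo[] : set (measurableTypeR R)).
    exact: measurable_itv.
  exists (~` (wait M x j n @^-1` [set` `]0%R, +oo[])); split.
  - by apply: measurableC; rewrite -[X in measurable X]setTI; exact: measurable_funP.
  - rewrite probability_setC; last first.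
      by rewrite -[X in measurable X]setTI; exact: measurable_funP.
    by rewrite prob_wait// pi_pos subee.
  - by move=> w /= nw pos; apply: nw; move: pos; rewrite /= in_itv /= andbT.
(* Quantifying over the value of the step as well reduces the claim to countably many singletons, to
   which [step_law] applies. *)
have S : {ae P, forall w, forall a : site d * nat * nat * site d,
    step M a.1.1.1 a.1.1.2 a.1.2 w = a.2 -> unit_step a.2}.
  apply: ae_forall_countable => -[[[x j] n] v] /=.
  case uv : (unit_step v); first by apply: aeW.
  exists (step M x j n @^-1` [set v]); split.
  - by rewrite -[X in measurable X]setTI; exact: measurable_funP.
  - by have := step_law M x j n v; rewrite uv.
  - by move=> w /= /not_implyP[].
apply: filterS2 W S => w Ww Sw; split => x j n; first exact: (Ww (x, j, n)).
exact: (Sw (x, j, n, _) erefl).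
Qed.

End Model.

(** * The initial distribution and the theorem *)

(* A named copy of [f], to which the measurability instance is attached. *)
Definition relabelling (f : nat -> nat) : nat -> nat := f.

HB.instance Definition _ (f : nat -> nat) :=
  isMeasurableFun.Build _ _ nat nat (relabelling f)
    (fun _ B _ => I : measurable (_ : set nat)).

(** The Poisson law serves as a concrete law charging every natural number, as the masses [q n]
    require. *)
Lemma poisson_prob1_gt0 (R : realType) (n : nat) :
  (0 < poisson_prob (1 : R) 0 [set n])%E.
Proof.
rewrite /poisson_prob ltr01 esum_set1; last by rewrite lee_fin poisson_pmf_ge0.
by rewrite lte_fin /poisson_pmf ltr01 expr1n mul1r mulr_gt0 ?expR_gt0//.
Qed.

Unset Implicit Arguments.

Theorem theorem2p2 (R : realType) (d : nat) (d_gt0 : (0 < d)%N)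
    (pi : probability (measurableTypeR R) R)
    (pi_pos : pi [set` `]0%R, +oo[] = 1%E)
    (pi_near0 : forall r : R, 0 < r -> (0 < pi [set` `]0%R, r]])%E) :
  exists mu : probability nat R,
    forall (dO : measure_display) (O : measurableType dO)
      (P : probability O R) (M : frog_model d pi mu P),
      {ae P, forall w : O, (explosion_time M w < +oo)%E}.
Proof.
pose u : R := (2 * d)%N%:R^-1.
have u01 : 0 < u <= 1.
  by rewrite invr_gt0 ltr0n muln_gt0 d_gt0 /= invf_le1 ?ler1n ?ltr0n muln_gt0.
pose nu : probability nat R := poisson_prob (1 : R) 0.
pose q n := fine (nu [set n]).
have qE n : nu [set n] = (q n)%:E by rewrite fineK// fin_num_measure.
have q01 n : 0 < q n <= 1.
  by rewrite -lte_fin -lee_fin -qE poisson_prob1_gt0 probability_le1.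
(* With this bound on each, [l] waiting times add up to at most [2^-n]; the successor avoids a
   division by zero. *)
pose delta n l : R := 2^-1 ^+ n / l.+1%:R.
have delta_gt0 n l : 0 < delta n l by rewrite divr_gt0// exprn_gt0// invr_gt0.
pose p n l := (u * fine (pi [set` `]0%R, delta n l]])) ^+ l.
have p01 n l : 0 < p n l <= 1.
  have mI : measurable ([set` `]0%R, delta n l]] : set (measurableTypeR R)).
    exact: measurable_itv.
  have : 0 < fine (pi [set` `]0%R, delta n l]]) <= 1.
    by rewrite -lte_fin -lee_fin fineK ?fin_num_measure// pi_near0//= probability_le1.
  move=> f01; have ? : 0 < u * fine (pi [set` `]0%R, delta n l]]).
    by rewrite mulr_gt0//; lra.
  rewrite exprn_gt0//= exprn_ile1//; first exact: ltW.
  by apply: mulr_ile1; lra.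
have [K [W [D [L [N HN]]]]] := @cascade_parameters R d u q p u01 q01 p01.
(* [mu] is the law of [N n] when [n] has law [nu]. As [N] may repeat values, the mass of [N n] is
   only bounded below by [q n]. *)
exists (distribution nu (relabelling N : {mfun nat >-> nat})) => dO O P M.
have qN n : ((q n)%:E <=
    distribution nu (relabelling N : {mfun nat >-> nat}) [set N n])%E.
  by rewrite -qE; apply: le_measure; rewrite ?inE// => _ ->.
pose i0 := Ordinal d_gt0.
have good n : fails_below P [set w |
    [/\ exists k, (k <= W n * K n)%N /\ eta M (walk_range M w 0 0 k) w = N n,
        forall x, x \in box (D n) -> exists l, (l < L n)%N /\
          eta M (x + direction i0 *+ l.+1) w = N n.+1 &
        forall x, x \in box (D n) -> exists j, [/\ (j < N n)%N,
          straight M w i0 x j (L n) & jump_time M w x j (L n) <= 2^-1 ^+ n]]]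
    (* Four errors of at most [2^-n]: two in the search of the first frog, one for the rich rays and
       one for the quick frogs. *)
    (4 * 2^-1 ^+ n).
  have [HK HW _ HL HNn] := HN n.
  have [_ q1] := andP (q01 n).
  have F := first_frog_finds M i0 (K n) (W n) q1 (qN n).
  have Rx x : x \in box (D n) -> _ := fun=> ray_rich M i0 x (L n) (qN n.+1).
  have Qx x : x \in box (D n) -> _ :=
    fun=> quick_straight_frog M i0 x (L n) (N n) (delta n (L n)).
  have := fails_belowI F (fails_belowI (fails_below_all Rx) (fails_below_all Qx)).
  apply: fails_belowW; last by rewrite -/u; move: HK HW HL HNn; rewrite /p; lra.
  move=> w [Fw [Rw Qw]]; split => // x /Qw[j [jN st qk]]; exists j; split => //.
  apply: (@le_trans _ _ (\sum_(i < L n) delta n (L n))).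
    by apply: ler_sum => i _; exact: qk.
  rewrite sumr_const card_ord -[leLHS]mulr_natr /delta mulrAC ler_pdivrMr ?ltr0n//.
  by rewrite ler_wpM2l ?exprn_ge0 ?invr_ge0// ler_nat.
apply: filterS2 (fails_below_eventually good) (ae_regular M pi_pos).
move=> w [n0 Hn0] [wait0 unit].
have [[k [kWK kN]] _ _] := Hn0 _ (leqnn n0).
have [_ _ [WK _] _ _] := HN n0.
apply: (@cascade_explosion _ _ _ _ _ _ _ M w wait0 i0 D L N n0
  (0 + jump_time M w 0 0 k) (walk_range M w 0 0 k)) => //.
- by move=> n _; have [_ _ []] := HN n.
- by move=> n x /Hn0[_ H _]; exact: H.
- by move=> n x /Hn0[_ _ H]; exact: H.
- by rewrite add0r; exact: jump_time_ge0.
- apply: le_box (leq_trans kWK WK) _.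
  by rewrite /walk_range add0r; exact: sum_steps_mem_box.
- apply: visited_by_next (visited_by_origin M w) (used_origin M w) _.
  exact: hitting_time_le.
Qed.
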